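(* Let $1\le m\le n/2$, $\delta>0$, $s:=m-\delta^2$, and put $$d=\frac{2m(n-m)}{n(n-1)(n+2)},\quad b=\frac{4(n-2m)^2}{n(n-2)(n+4)},\quad c=\frac{2m^2(n-m)^2}{n^2(n-1)(n+2)}.$$ If $s\in\Big]\frac{m^2}{n},\ \frac{m^2}{n}+\frac b2+\sqrt{\frac{b^2}{4}+c}\Big[$, then every $\delta$-code $C\subset\mathcal G_{m,n}$ satisfies $$|C|\le\frac{(m-s)\big(s-\frac{m^2}{n}+d\big)^2(n-1)(n+2)}{2\big(s-\frac{m^2}{n}\big)\Big(-\big(s-\frac{m^2}{n}\big)^2+b\big(s-\frac{m^2}{n}\big)+c\Big)}.$$
   Context: $\mathcal G_{m,n}$ is the set of $m$-dimensional linear subspaces of $\mathbb R^n$. For $p,q\in\mathcal G_{m,n}$ with principal angles $\theta_1,\dots,\theta_m\in[0,\pi/2]$ (defined recursively: $\theta_1$ is the minimal angle between a line of $p$ and a line of $q$, the rest are the principal angles of the orthogonal complements of these lines in $p$ and $q$), the chordal distance is $d_c(p,q)=\sqrt{\sum_i\sin^2\theta_i}$. A $\delta$-code is a finite $C\subset\mathcal G_{m,n}$ with $d_c(p,q)\ge\delta$ for all distinct $p,q\in C$. *)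

(* Defs.v *)
From HB Require Import structures.
From mathcomp Require Import all_boot all_order all_algebra.
From mathcomp Require Import all_classical all_reals all_analysis.
Set Implicit Arguments. Unset Strict Implicit. Unset Printing Implicit Defensive.
Import Order.TTheory GRing.Theory Num.Theory.
Local Open Scope ring_scope.

Section Grassmann.
Variables (R : realType) (n : nat).

Definition dotv (u v : 'rV[R]_n) : R := (u *m v^T) 0 0.
Definition normv (u : 'rV[R]_n) : R := Num.sqrt (dotv u u).

Definition line_cos (u v : 'rV[R]_n) : R := `|dotv u v| / (normv u * normv v).

Definition line_angle (u v : 'rV[R]_n) : R := acos (line_cos u v).

Definition orthl (u : 'rV[R]_n) : 'M[R]_n := kermx u^T.

Fixpoint principal_angles (P Q : 'M[R]_n) (th : seq R) : Prop :=
  match th with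
  | [::] => True
  | t :: th' =>
      exists u v : 'rV[R]_n,
        [/\ u != 0, v != 0, (u <= P)%MS & (v <= Q)%MS] /\
        [/\ (forall u' v' : 'rV[R]_n, u' != 0 -> v' != 0 ->
                (u' <= P)%MS -> (v' <= Q)%MS ->
                line_angle u v <= line_angle u' v'),
            t = line_angle u v &
            principal_angles (P :&: orthl u)%MS (Q :&: orthl v)%MS th']
  end.

Definition chordal_dist (m : nat) (p q : 'M[R]_(m, n)) (d : R) : Prop :=
  exists th : seq R, [/\ size th = m,
     principal_angles <<p>>%MS <<q>>%MS th &
     d = Num.sqrt (\sum_(t <- th) sin t ^+ 2)].

(* A delta-code in G_{m,n}: a finite list C of m x n matrices of rank m
   (each representing its row space, a point of G_{m,n}), without
   repetitions, whose distinct members have chordal distance >= delta. *)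
Definition delta_code (m : nat) (delta : R) (C : seq 'M[R]_(m, n)) : Prop :=
  [/\ uniq C, all (fun p => row_free p) C &
      forall p q, p \in C -> q \in C -> p != q ->
        forall d, chordal_dist p q d -> delta <= d].

End Grassmann.

(* Main.v *)
Require Import Defs.
From HB Require Import structures.
From mathcomp Require Import all_boot all_order all_algebra.
From mathcomp Require Import all_classical all_reals all_analysis.
From mathcomp Require Import ring lra.
Import Order.TTheory GRing.Theory Num.Theory.
Import numFieldNormedType.Exports.
Local Open Scope ring_scope.
Set Implicit Arguments. Unset Strict Implicit. Unset Printing Implicit Defensive.

(** Let [P], [Q] be the orthogonal projections onto [p], [q], so that
    [d_c(p,q)^2 = m - tr(PQ)], and put [z = tr(PQ) - m^2/n], which is at most [x]
    off the diagonal of a code and equals [z0 = m - m^2/n] on it.  With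
    [p2(z) = z^2 - b z - c], the kernels [z] and [p2(z)] are positive
    semidefinite: [z] is the inner product of the traceless parts, and [p2(z)] is
    the inner product of the totally traceless parts of the tensors [P (x) P] and
    [Q (x) Q].  By the Schur product theorem [z p2(z)] is also positive
    semidefinite.  The polynomial [F(z) = (z - x)(x z + c)^2] is nonpositive for
    [z <= x], and [F - F0], where [F0 = c x (- p2(x))] is its mean, is a
    nonnegative combination of these three kernels; hence
    [N^2 F0 <= sum F(z) <= N F(z0)].

    That [d_c(p,q)^2 = m - tr(PQ)] is obtained by choosing a unit vector [u] of
    [p] maximizing [|uQ|]; with [v] the direction of [uQ], the pair realizes the
    first principal angle, and one passes to [P - u^T u] and [Q - v^T v]. *)

(** * The traceless part of the tensor square of a projection *)

Section Frame.
Variables (R : realFieldType) (n : nat).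
Implicit Types (P Q : 'M[R]_n) (f g : 'I_n -> 'I_n -> 'I_n -> 'I_n -> R).

Definition sum4 f : R := \sum_i \sum_j \sum_k \sum_l f i j k l.

Lemma eq_sum4 f g :
  (forall i j k l, f i j k l = g i j k l) -> sum4 f = sum4 g.
Proof.
by move=> fg; do 4!(apply: eq_bigr => ? _); rewrite fg.
Qed.

Lemma sum4D f g : sum4 (fun i j k l => f i j k l + g i j k l) = sum4 f + sum4 g.
Proof.
rewrite /sum4 -big_split; do 3!(apply: eq_bigr => ? _; rewrite -big_split).
exact: eq_bigr.
Qed.

Lemma sum4Z (a : R) f : sum4 (fun i j k l => a * f i j k l) = a * sum4 f.
Proof.
rewrite /sum4 mulr_sumr; do 3!(apply: eq_bigr => ? _; rewrite mulr_sumr).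
exact: eq_bigr.
Qed.

Lemma exchange_sum4 (J : finType) (h : J -> 'I_n -> 'I_n -> 'I_n -> 'I_n -> R) :
  \sum_t sum4 (h t) = sum4 (fun i j k l => \sum_t h t i j k l).
Proof.
rewrite /sum4 exchange_big; do 3!(apply: eq_bigr => ? _; rewrite exchange_big).
exact: eq_bigr.
Qed.

Lemma sum4_perm12 f : sum4 f = sum4 (fun i j k l => f j i k l).
Proof. exact: exchange_big. Qed.

Lemma sum4_perm23 f : sum4 f = sum4 (fun i j k l => f i k j l).
Proof. by apply: eq_bigr => i _; rewrite exchange_big. Qed.

Lemma sum4_perm34 f : sum4 f = sum4 (fun i j k l => f i j l k).
Proof. by do 2!(apply: eq_bigr => ? _); rewrite exchange_big. Qed.

Definition kron (i j : 'I_n) : R := (i == j)%:R.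

Lemma kronC i j : kron i j = kron j i.
Proof. by rewrite /kron eq_sym. Qed.

Lemma sum_kron (i : 'I_n) (h : 'I_n -> R) : \sum_j kron i j * h j = h i.
Proof.
rewrite (bigD1 i) //= {1}/kron eqxx mul1r big1 ?addr0 // => j.
by rewrite /kron eq_sym => /negPf ->; rewrite mul0r.
Qed.

Lemma sum_kron_diag : \sum_i kron i i = n%:R.
Proof.
rewrite (eq_bigr (fun=> 1)) => [|i _]; last by rewrite /kron eqxx.
by rewrite sumr_const card_ord.
Qed.

Lemma sum4_kron12 (g : 'I_n -> 'I_n -> 'I_n -> 'I_n -> R) :
  sum4 (fun i j k l => kron i j * g i j k l) = \sum_i \sum_k \sum_l g i i k l.
Proof.
apply: eq_bigr => i _.
rewrite -[RHS](sum_kron i (fun j => \sum_k \sum_l g i j k l)).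
apply: eq_bigr => j _; rewrite mulr_sumr; apply: eq_bigr => k _.
by rewrite mulr_sumr.
Qed.

(** Summing over the contracted pair first leaves a vanishing inner sum. Pairs in other positions
    are moved to the front by permuting the four indices. *)
Lemma sum4_traceless f (G : 'I_n -> 'I_n -> R) :
  (forall k l, \sum_i f i i k l = 0) ->
  sum4 (fun i j k l => kron i j * (G k l * f i j k l)) = 0.
Proof.
move=> f0; rewrite sum4_kron12 exchange_big /= big1 // => k _.
by rewrite exchange_big /= big1 // => l _; rewrite -mulr_sumr f0 mulr0.
Qed.

Definition dot2 (G H : 'I_n -> 'I_n -> R) : R := \sum_i \sum_j G i j * H i j.

Variables (m a1 a2 a3 a4 : R).

(* The part of [P i j * P k l] orthogonal to the tensors built from the identity
   and one traceless matrix; [coef1] to [coef4] below say that all contractions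
   vanish when [P] is a projection of trace [m]. *)
Definition tensor P i j k l : R :=
  P i j * P k l - a1 * (kron i j * P k l + kron k l * P i j)
  - a2 * (kron i k * P j l + kron i l * P j k
          + kron j k * P i l + kron j l * P i k)
  + a3 * (kron i j * kron k l)
  + a4 * (kron i k * kron j l + kron i l * kron j k).

Definition orth_proj P := P^T = P /\ P *m P = P.

Lemma orth_proj_sym P i j : orth_proj P -> P i j = P j i.
Proof. by case=> PT _; rewrite -{1}PT mxE. Qed.

Lemma orth_proj_idem P i k : orth_proj P -> \sum_j P i j * P j k = P i k.
Proof. by case=> _ PP; rewrite -[in RHS]PP mxE. Qed.

Lemma tensor_sym12 P i j k l : orth_proj P ->
  tensor P i j k l = tensor P j i k l.
Proof.
move=> hP; rewrite /tensor (kronC j i) (orth_proj_sym j i hP); ring.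
Qed.

Lemma tensor_sym34 P i j k l : orth_proj P ->
  tensor P i j k l = tensor P i j l k.
Proof.
move=> hP; rewrite /tensor (kronC l k) (orth_proj_sym l k hP); ring.
Qed.

(** [coef1] and [coef2] kill the coefficients of [P k l] and [kron k l] in the contraction of
    indices 1 and 2. [coef3] and [coef4] do the same for indices 1 and 3, where the leading 1 comes
    from [P *m P = P]. *)
Hypothesis coef1 : m - n%:R * a1 - 4 * a2 = 0.
Hypothesis coef2 : - a1 * m + n%:R * a3 + 2 * a4 = 0.
Hypothesis coef3 : 1 - 2 * a1 - (n%:R + 2) * a2 = 0.
Hypothesis coef4 : - a2 * m + a3 + (n%:R + 1) * a4 = 0.

Lemma tensor_contract12 P k l : orth_proj P -> \tr P = m ->
  \sum_i tensor P i i k l = 0.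
Proof.
move=> hP tP.
rewrite (eq_bigr (fun i => (P k l - a1 * kron k l) * P i i
    + (a3 * kron k l - a1 * P k l) * kron i i
    + (- 2 * a2) * (kron k i * P i l) + (- 2 * a2) * (kron l i * P i k)
    + (2 * a4) * (kron k i * kron i l))); last first.
  by move=> i _; rewrite /tensor (kronC i k) (kronC l i) (kronC i l); ring.
rewrite !big_split /= -!mulr_sumr !sum_kron sum_kron_diag.
have -> : \sum_i P i i = m by rewrite -tP.
rewrite (orth_proj_sym l k hP).
transitivity ((m - n%:R * a1 - 4 * a2) * P k l
  + (- a1 * m + n%:R * a3 + 2 * a4) * kron k l); first by ring.
by rewrite coef1 coef2 !mul0r addr0.
Qed.

Lemma tensor_contract13 P j l : orth_proj P -> \tr P = m ->
  \sum_i tensor P i j i l = 0.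
Proof.
move=> hP tP.
rewrite (eq_bigr (fun i => P j i * P i l
    + (- a1) * (kron j i * P i l) + (- a1) * (kron l i * P i j)
    + (- a2 * P j l + a4 * kron j l) * kron i i + (- a2) * (kron l i * P j i)
    + (- a2) * (kron j i * P i l) + (- a2 * kron j l) * P i i
    + (a3 + a4) * (kron j i * kron i l))); last first.
  move=> i _; rewrite /tensor (orth_proj_sym i j hP).
  by rewrite (kronC i j) (kronC l i) (kronC i l); ring.
rewrite !big_split /= -!mulr_sumr !sum_kron sum_kron_diag orth_proj_idem //.
have -> : \sum_i P i i = m by rewrite -tP.
rewrite (orth_proj_sym l j hP).
transitivity ((1 - 2 * a1 - (n%:R + 2) * a2) * P j l
  + (- a2 * m + a3 + (n%:R + 1) * a4) * kron j l); first by ring.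
by rewrite coef3 coef4 !mul0r addr0.
Qed.

Section InnerProduct.
Variables P Q : 'M[R]_n.
Hypotheses (hP : orth_proj P) (tP : \tr P = m).
Hypotheses (hQ : orth_proj Q) (tQ : \tr Q = m).

Lemma dot2_kron : dot2 kron Q = m.
Proof. by rewrite -tQ; apply: eq_bigr => i _; rewrite sum_kron. Qed.

Lemma sum4_kron12_sq (G : 'I_n -> 'I_n -> R) :
  sum4 (fun i j k l => kron i j * (G k l * (Q i j * Q k l))) = m * dot2 G Q.
Proof.
rewrite sum4_kron12 -tQ mulr_suml; apply: eq_bigr => i _.
rewrite mulr_sumr; apply: eq_bigr => k _; rewrite mulr_sumr.
by apply: eq_bigr => l _; ring.
Qed.

(** A contraction across the two factors of Q (x) Q produces Q Q = Q, so no factor [m] appears,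
    unlike for a contraction inside one factor. By symmetry of [Q] all four crossed pairs reduce to
    this one. *)
Lemma sum4_kron13_sq (G : 'I_n -> 'I_n -> R) :
  sum4 (fun i j k l => kron i k * (G j l * (Q i j * Q k l))) = dot2 G Q.
Proof.
rewrite sum4_perm23 sum4_kron12 exchange_big; apply: eq_bigr => j _.
rewrite exchange_big; apply: eq_bigr => l _; rewrite -mulr_sumr.
rewrite -(orth_proj_idem j l hQ); congr (_ * _).
by apply: eq_bigr => i _; rewrite (orth_proj_sym i j hQ).
Qed.

Lemma sum4_sq :
  sum4 (fun i j k l => P i j * P k l * (Q i j * Q k l)) = dot2 P Q ^+ 2.
Proof.
rewrite expr2 {1}/dot2 mulr_suml; apply: eq_bigr => i _.
rewrite mulr_suml; apply: eq_bigr => j _; rewrite mulr_sumr.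
apply: eq_bigr => k _; rewrite mulr_sumr; apply: eq_bigr => l _; ring.
Qed.

Lemma sum4_tensor_proj :
  sum4 (fun i j k l => tensor P i j k l * (Q i j * Q k l)) =
  dot2 P Q ^+ 2 - (2 * a1 * m + 4 * a2) * dot2 P Q + (a3 * m + 2 * a4) * m.
Proof.
pose q i j k l := Q i j * Q k l.
have e12 G : sum4 (fun i j k l => kron i j * (G k l * q i j k l)) = m * dot2 G Q.
  exact: sum4_kron12_sq.
have e34 G : sum4 (fun i j k l => kron k l * (G i j * q i j k l)) = m * dot2 G Q.
  (* These four transpositions compose to the exchange of the pairs (i, j) and (k, l). *)
  rewrite -sum4_kron12_sq sum4_perm23 sum4_perm12 sum4_perm34 sum4_perm23.
  by apply: eq_sum4 => i j k l; rewrite /q; ring.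
have e13 G : sum4 (fun i j k l => kron i k * (G j l * q i j k l)) = dot2 G Q.
  exact: sum4_kron13_sq.
have e14 G : sum4 (fun i j k l => kron i l * (G j k * q i j k l)) = dot2 G Q.
  rewrite -sum4_kron13_sq sum4_perm34; apply: eq_sum4 => i j k l.
  by rewrite /q (orth_proj_sym l k hQ).
have e23 G : sum4 (fun i j k l => kron j k * (G i l * q i j k l)) = dot2 G Q.
  rewrite -sum4_kron13_sq sum4_perm12; apply: eq_sum4 => i j k l.
  by rewrite /q (orth_proj_sym j i hQ).
have e24 G : sum4 (fun i j k l => kron j l * (G i k * q i j k l)) = dot2 G Q.
  rewrite -sum4_kron13_sq sum4_perm12 sum4_perm34; apply: eq_sum4 => i j k l.
  by rewrite /q (orth_proj_sym j i hQ) (orth_proj_sym l k hQ).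
transitivity (sum4 (fun i j k l => P i j * P k l * (Q i j * Q k l)
  + (- a1) * (kron i j * (P k l * q i j k l))
  + (- a1) * (kron k l * (P i j * q i j k l))
  + (- a2) * (kron i k * (P j l * q i j k l))
  + (- a2) * (kron i l * (P j k * q i j k l))
  + (- a2) * (kron j k * (P i l * q i j k l))
  + (- a2) * (kron j l * (P i k * q i j k l))
  + a3 * (kron i j * (kron k l * q i j k l))
  + a4 * (kron i k * (kron j l * q i j k l))
  + a4 * (kron i l * (kron j k * q i j k l)))).
  by apply: eq_sum4 => i j k l; rewrite /tensor /q; ring.
rewrite !(sum4D, sum4Z) !(e12 P, e12 kron, e34 P, e13 P, e13 kron).
by rewrite !(e14 P, e14 kron, e23 P, e24 P) sum4_sq dot2_kron; ring.
Qed.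

(** Every correction term of [tensor Q] contains a Kronecker delta, hence contracts [tensor P] to 0.
    Only the pairing of [tensor P] with Q (x) Q survives. *)
Lemma sum4_tensor :
  sum4 (fun i j k l => tensor P i j k l * tensor Q i j k l) =
  dot2 P Q ^+ 2 - (2 * a1 * m + 4 * a2) * dot2 P Q + (a3 * m + 2 * a4) * m.
Proof.
pose t := tensor P.
have s12 i j k l : t i j k l = t j i k l by exact: tensor_sym12.
have s34 i j k l : t i j k l = t i j l k by exact: tensor_sym34.
have s13 i j k l : t i j k l = t k l i j.
  rewrite /t /tensor (kronC k i) (kronC k j) (kronC l i) (kronC l j).
  rewrite (orth_proj_sym l j hP) (orth_proj_sym l i hP).
  by rewrite (orth_proj_sym k j hP) (orth_proj_sym k i hP); ring.
have e12 G : sum4 (fun i j k l => kron i j * (G k l * t i j k l)) = 0.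
  by apply: sum4_traceless => k l; apply: tensor_contract12.
have e34 G : sum4 (fun i j k l => kron k l * (G i j * t i j k l)) = 0.
  rewrite -(e12 G) sum4_perm23 sum4_perm12 sum4_perm34 sum4_perm23.
  by apply: eq_sum4 => i j k l; rewrite s13; ring.
have e13 G : sum4 (fun i j k l => kron i k * (G j l * t i j k l)) = 0.
  rewrite sum4_perm23.
  apply: (@sum4_traceless (fun i j k l => t i k j l)) => k l.
  exact: tensor_contract13.
have e14 G : sum4 (fun i j k l => kron i l * (G j k * t i j k l)) = 0.
  by rewrite -(e13 G) sum4_perm34; apply: eq_sum4 => i j k l; rewrite s34.
have e23 G : sum4 (fun i j k l => kron j k * (G i l * t i j k l)) = 0.
  by rewrite -(e13 G) sum4_perm12; apply: eq_sum4 => i j k l; rewrite s12.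
have e24 G : sum4 (fun i j k l => kron j l * (G i k * t i j k l)) = 0.
  by rewrite -(e14 G) sum4_perm12; apply: eq_sum4 => i j k l; rewrite s12.
rewrite -sum4_tensor_proj.
transitivity (sum4 (fun i j k l => t i j k l * (Q i j * Q k l)
  + (- a1) * (kron i j * (Q k l * t i j k l))
  + (- a1) * (kron k l * (Q i j * t i j k l))
  + (- a2) * (kron i k * (Q j l * t i j k l))
  + (- a2) * (kron i l * (Q j k * t i j k l))
  + (- a2) * (kron j k * (Q i l * t i j k l))
  + (- a2) * (kron j l * (Q i k * t i j k l))
  + a3 * (kron i j * (kron k l * t i j k l))
  + a4 * (kron i k * (kron j l * t i j k l))
  + a4 * (kron i l * (kron j k * t i j k l)))).
  by apply: eq_sum4 => i j k l; rewrite /t {2}/tensor; ring.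
rewrite !(sum4D, sum4Z) !(e12 Q, e12 kron, e34 Q, e13 Q, e13 kron).
by rewrite !(e14 Q, e14 kron, e23 Q, e24 Q); ring.
Qed.

End InnerProduct.


End Frame.

(** * The linear programming bound *)

(* By Christoffel-Darboux, [(y - x) * (x * y + c)] is a nonnegative combination
   of [y] and [y ^+ 2 - b * y - c]; multiplying once more by [x * y + c] keeps
   every coefficient in the expansion [FE] nonnegative. *)
Lemma cubic_kernel_bound (R : realFieldType) (I : finType) (z : I -> I -> R)
    (b c x z0 : R) :
  0 <= b -> 0 < c -> 0 < x -> x <= z0 -> 0 < - x ^+ 2 + b * x + c ->
  (forall i, z i i = z0) -> (forall i j, i != j -> z i j <= x) ->
  0 <= \sum_i \sum_j z i j ->
  0 <= \sum_i \sum_j (z i j ^+ 2 - b * z i j - c) ->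
  0 <= \sum_i \sum_j (z i j ^+ 2 - b * z i j - c) * z i j ->
  #|I|%:R <= (z0 - x) * (z0 * x + c) ^+ 2 / (c * x * (- x ^+ 2 + b * x + c)).
Proof.
set q := - x ^+ 2 + b * x + c => b0 c0 x0 xz0 q0 z_diag z_off h1 h2 h3.
pose p2 y := y ^+ 2 - b * y - c; pose F y := (y - x) * (x * y + c) ^+ 2.
have FE y : F y = x ^+ 2 * (p2 y * y) + (x * c + q * x) * p2 y
   + (q * x * b + q * c) * y + q * x * c.
  by rewrite /F /p2 /q; ring.
have A_gt0 : 0 < q * x * c by rewrite (mulr_gt0 (mulr_gt0 q0 x0) c0).
have lower : #|I|%:R ^+ 2 * (q * x * c) <= \sum_i \sum_j F (z i j).
  have -> : \sum_i \sum_j F (z i j) =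
      x ^+ 2 * (\sum_i \sum_j p2 (z i j) * z i j)
      + (x * c + q * x) * (\sum_i \sum_j p2 (z i j))
      + (q * x * b + q * c) * (\sum_i \sum_j z i j)
      + #|I|%:R ^+ 2 * (q * x * c).
    under eq_bigr => i _ do (under eq_bigr => j _ do rewrite FE;
      rewrite !big_split /= -!mulr_sumr).
    rewrite !big_split /= -!mulr_sumr; congr (_ + _).
    by rewrite !sumr_const -mulrnA -[_ *+ (_ * _)%N]mulr_natl natrM; ring.
  have [x0' q0' c0'] := And3 (ltW x0) (ltW q0) (ltW c0).
  by rewrite lerDr !addr_ge0 // mulr_ge0 ?sqr_ge0 // addr_ge0 ?mulr_ge0.
have upper : \sum_i \sum_j F (z i j) <= #|I|%:R * F z0.
  rewrite -sum1_card natr_sum mulr_suml; apply: ler_sum => i _.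
  rewrite mul1r (bigD1 i) //= z_diag gerDl; apply: sumr_le0 => j ji.
  by rewrite /F mulr_le0_ge0 ?sqr_ge0 // subr_le0 z_off // eq_sym.
have -> : (z0 - x) * (z0 * x + c) ^+ 2 = F z0 by rewrite /F; ring.
rewrite (_ : c * x * q = q * x * c) ?ler_pdivlMr //; last by ring.
(* One factor [#|I|] is about to be cancelled, so the empty family is treated apart. *)
have [->|N_neq0] := eqVneq #|I| 0%N.
  by rewrite mul0r mulr_ge0 ?sqr_ge0 // subr_ge0.
rewrite -(ler_pM2l (_ : 0 < #|I|%:R)) ?ltr0n ?lt0n // mulrA -expr2.
exact: le_trans lower upper.
Qed.

(** * Positive semidefinite kernels of a family of projections *)

Section Kernels.
Variables (R : realFieldType) (n m : nat) (I : finType) (P : I -> 'M[R]_n).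
Hypotheses (m_gt0 : (0 < m)%N) (m2_le_n : (m.*2 <= n)%N).
Hypotheses (projP : forall i, orth_proj (P i)) (trP : forall i, \tr (P i) = m%:R).

Let nu : R := n%:R.
Let mu : R := m%:R.
Let b : R := 4 * (nu - 2 * mu) ^+ 2 / (nu * (nu - 2) * (nu + 4)).
Let c : R := 2 * mu ^+ 2 * (nu - mu) ^+ 2 / (nu ^+ 2 * (nu - 1) * (nu + 2)).
Let z i j : R := dot2 (P i) (P j) - mu ^+ 2 / nu.
Let z0 : R := mu - mu ^+ 2 / nu.

Let mu_ge1 : 1 <= mu. Proof. by rewrite ler1n. Qed.
Let nu_ge2mu : 2 * mu <= nu.
Proof. by rewrite /nu /mu -natrM ler_nat mul2n. Qed.

Lemma b_ge0 : 0 <= b.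
Proof.
have := mu_ge1; have := nu_ge2mu => h1 h2.
by rewrite /b divr_ge0 ?mulr_ge0 ?sqr_ge0 //; lra.
Qed.

Lemma c_gt0 : 0 < c.
Proof.
have := mu_ge1; have := nu_ge2mu => h1 h2.
by rewrite /c divr_gt0 ?mulr_gt0 ?exprn_gt0 //; lra.
Qed.

Lemma dot2_self i : dot2 (P i) (P i) = mu.
Proof.
rewrite /mu -(trP i); apply: eq_bigr => k _; rewrite -(orth_proj_idem k k (projP i)).
by apply: eq_bigr => l _; rewrite (orth_proj_sym l k (projP i)).
Qed.

Lemma z_self i : z i i = z0.
Proof. by rewrite /z dot2_self. Qed.

Definition traceless i k l : R := P i k l - mu / nu * kron R k l.

(** The two cross terms contribute - mu^2/nu each and the product of the scalar parts + mu^2/nu.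
    This exhibits [z] as a Gram kernel. *)
Lemma z_traceless i j : z i j = \sum_k \sum_l traceless i k l * traceless j k l.
Proof.
have nu_neq0 : nu != 0 by have := mu_ge1; have := nu_ge2mu => h1 h2; apply/eqP; lra.
have -> : \sum_k \sum_l traceless i k l * traceless j k l =
    \sum_k (\sum_l P i k l * P j k l - (mu / nu) * \sum_l kron R k l * P i k l
     - (mu / nu) * \sum_l kron R k l * P j k l
     + (mu / nu) ^+ 2 * \sum_l kron R k l * kron R k l).
  apply: eq_bigr => k _; rewrite !mulr_sumr -!sumrB -big_split.
  by apply: eq_bigr => l _; rewrite /traceless /=; ring.
rewrite big_split sumrB /= sumrB -!mulr_sumr.
have e j' : \sum_k \sum_l kron R k l * P j' k l = mu by exact: (dot2_kron (trP j')).
have e' : \sum_(k < n) \sum_l kron R k l * kron R k l = nu.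
  by rewrite -[nu](sum_kron_diag R); apply: eq_bigr => k _; exact: sum_kron.
by rewrite !e e' /z /dot2; field; exact: nu_neq0.
Qed.

Lemma sum_sqr (w f : I -> R) :
  \sum_i \sum_j w i * w j * (f i * f j) = (\sum_i w i * f i) ^+ 2.
Proof.
rewrite expr2 mulr_suml; apply: eq_bigr => i _.
by rewrite mulr_sumr; apply: eq_bigr => j _; ring.
Qed.

Lemma gram_sum4 (w : I -> R) (f : I -> 'I_n -> 'I_n -> 'I_n -> 'I_n -> R) :
  0 <= \sum_i \sum_j w i * w j *
         sum4 (fun k l u v => f i k l u v * f j k l u v).
Proof.
under eq_bigr => i _ do (under eq_bigr => j _ do rewrite -sum4Z;
  rewrite exchange_sum4).
rewrite exchange_sum4; do 4!(apply: sumr_ge0 => ? _).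
by rewrite sum_sqr sqr_ge0.
Qed.

(** This is the mechanism of the Schur product theorem: for fixed [k] and [l] the inner sum is the
    quadratic form of [g] at the weights [traceless i k l]. *)
Lemma sum_z (g : I -> I -> R) : \sum_i \sum_j g i j * z i j =
  \sum_k \sum_l \sum_i \sum_j traceless i k l * traceless j k l * g i j.
Proof.
under eq_bigr => i _ do (under eq_bigr => j _ do
  (rewrite z_traceless mulr_sumr; under eq_bigr => k _ do rewrite mulr_sumr);
  rewrite exchange_big; under eq_bigr => k _ do rewrite exchange_big).
rewrite /= exchange_big; apply: eq_bigr => k _; rewrite exchange_big.
by apply: eq_bigr => l _; do 2!(apply: eq_bigr => ? _); ring.
Qed.

Lemma z_psd (w : I -> R) : 0 <= \sum_i \sum_j w i * w j * z i j.
Proof.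
rewrite sum_z; do 2!(apply: sumr_ge0 => ? _).
under eq_bigr => i _ do under eq_bigr => j _ do rewrite mulrC.
by rewrite sum_sqr sqr_ge0.
Qed.

Let p2 y : R := y ^+ 2 - b * y - c.

Lemma p2_psd (w : I -> R) : 0 <= \sum_i \sum_j w i * w j * p2 (z i j).
Proof.
have h1 := mu_ge1; have h2 := nu_ge2mu.
have nu4 : nu + 4 != 0 by apply/eqP; lra.
(* The system [coef1] to [coef4] is solved: eliminating [a1] from the first and third equations
   gives [a2], since nu^2 + 2 nu - 8 = (nu - 2)(nu + 4). *)
pose a2 := (nu - 2 * mu) / ((nu - 2) * (nu + 4)).
(* For [n = 2] one has [m = 1], and the junk value [a2 = 0] still works. *)
have ha2 : a2 * (nu - 2) * (nu + 4) = nu - 2 * mu.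
  have [e|ne] := eqVneq (nu - 2) 0; first by rewrite e mulr0 mul0r; lra.
  by rewrite /a2; field; rewrite ne nu4.
(* Substituting for [mu] in terms of [a2] keeps [nu - 2], possibly 0, out of the denominators met by
   [field]. *)
have muE : mu = (nu - a2 * (nu - 2) * (nu + 4)) / 2 by rewrite ha2; field.
have nu0 : nu != 0 by apply/eqP; lra.
have nu1 : nu - 1 != 0 by apply/eqP; lra.
have nu2 : nu + 2 != 0 by apply/eqP; lra.
have bE : b = 4 * a2 * (nu - 2 * mu) / nu.
  rewrite /b /a2; have [e|ne] := eqVneq (nu - 2) 0.
    by rewrite e !(mul0r, mulr0, invr0).
  by field; rewrite ne nu0 nu4.
(* [a1] is read off [coef1] and [a3] off [coef4]; [coef2] then yields [a4], with nu^2 + nu - 2 = (nu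
   - 1)(nu + 2). *)
pose a1 := (mu - 4 * a2) / nu.
pose a4 := mu * (nu * a2 - a1) / ((nu - 1) * (nu + 2)).
pose a3 := a2 * mu - (nu + 1) * a4.
have := gram_sum4 w (fun i => tensor a1 a2 a3 a4 (P i)).
congr (0 <= _); apply: eq_bigr => i _; apply: eq_bigr => j _; congr (_ * _).
rewrite (@sum4_tensor _ _ mu) //.
- rewrite /p2 /z bE /c /a3 /a4 /a1; move: (dot2 _ _) => y.
  rewrite muE; field; rewrite nu0 nu1 nu2 //.
- by rewrite -/nu /a1; field.
- by rewrite -/nu /a3 /a4 /a1 muE; field; rewrite nu0 nu1 nu2.
- rewrite -/nu /a1 muE; field; rewrite nu0 //.
- by rewrite -/nu /a3; ring.
Qed.

Lemma p2z_psd : 0 <= \sum_i \sum_j p2 (z i j) * z i j.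
Proof. by rewrite sum_z; do 2!(apply: sumr_ge0 => ? _); exact: p2_psd. Qed.

Lemma code_bound (s : R) (x := s - mu ^+ 2 / nu) :
  0 < x -> s < mu -> 0 < - x ^+ 2 + b * x + c ->
  (forall i j, i != j -> dot2 (P i) (P j) <= s) ->
  #|I|%:R <= (mu - s) * (z0 * x + c) ^+ 2 / (c * x * (- x ^+ 2 + b * x + c)).
Proof.
move=> x_gt0 s_lt q_gt0 code.
have -> : mu - s = z0 - x by rewrite /z0 /x; ring.
apply: (@cubic_kernel_bound R I z b c x z0 b_ge0 c_gt0 x_gt0 _ q_gt0).
- by rewrite lerD2r ltW.
- exact: z_self.
- by move=> i j ij; rewrite lerD2r; exact: code.
- have := z_psd (fun=> 1).
  by under eq_bigr => i _ do under eq_bigr => j _ do rewrite !mul1r.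
- have := p2_psd (fun=> 1).
  by under eq_bigr => i _ do under eq_bigr => j _ do rewrite !mul1r.
- exact: p2z_psd.
Qed.

End Kernels.

(** * Principal angles and projections *)

Section Angles.
Variables (R : realType) (n : nat).
Implicit Types (P Q A B : 'M[R]_n) (u v w : 'rV[R]_n).

Lemma dotvE u v : dotv u v = \sum_i u 0 i * v 0 i.
Proof. by rewrite /dotv mxE; apply: eq_bigr => i _; rewrite mxE. Qed.

Lemma dotvC u v : dotv u v = dotv v u.
Proof. by rewrite !dotvE; apply: eq_bigr => i _; rewrite mulrC. Qed.

Lemma dotvDl u v w : dotv (u + v) w = dotv u w + dotv v w.
Proof. by rewrite /dotv mulmxDl mxE. Qed.

Lemma dotvZl a u w : dotv (a *: u) w = a * dotv u w.
Proof. by rewrite /dotv -scalemxAl mxE. Qed.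

Lemma dotvDr u v w : dotv w (u + v) = dotv w u + dotv w v.
Proof. by rewrite !(dotvC w) dotvDl. Qed.

Lemma dotvZr a u w : dotv w (a *: u) = a * dotv w u.
Proof. by rewrite !(dotvC w) dotvZl. Qed.

Lemma dotvv_ge0 u : 0 <= dotv u u.
Proof. by rewrite dotvE sumr_ge0 // => i _; rewrite -expr2 sqr_ge0. Qed.

Lemma dotvv_eq0 u : dotv u u = 0 -> u = 0.
Proof.
rewrite dotvE => /psumr_eq0P h; apply/rowP => i; rewrite mxE.
by apply/eqP; rewrite -sqrf_eq0 expr2 h // => j _; rewrite -expr2 sqr_ge0.
Qed.

Lemma dotvv_gt0 u : u != 0 -> 0 < dotv u u.
Proof.
move=> u0; rewrite lt_neqAle dotvv_ge0 andbT eq_sym.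
by apply: contra u0 => /eqP /dotvv_eq0 ->.
Qed.

Lemma dotv1_neq0 u : dotv u u = 1 -> u != 0.
Proof.
move=> u1; apply/eqP => u0; move: u1; rewrite u0 /dotv mul0mx mxE => /eqP.
by rewrite eq_sym oner_eq0.
Qed.

Lemma dotv_mulmx u v P : P^T = P -> dotv (u *m P) v = dotv u (v *m P).
Proof. by move=> PT; rewrite /dotv trmx_mul PT mulmxA. Qed.

Lemma dotv_CauchySchwarz u v : dotv u v ^+ 2 <= dotv u u * dotv v v.
Proof.
have [->|v0] := eqVneq v 0.
  by rewrite /dotv trmx0 !mulmx0 mxE expr0n mulr0.
have := dotvv_ge0 (dotv v v *: u - dotv u v *: v).
rewrite -scaleNr !(dotvDl, dotvDr, dotvZl, dotvZr) (dotvC v u) => h.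
rewrite -subr_ge0 -(pmulr_rge0 _ (dotvv_gt0 v0)).
by apply: le_trans h _; rewrite le_eqVlt; apply/orP; left; apply/eqP; ring.
Qed.

Lemma normvE u : normv u ^+ 2 = dotv u u.
Proof. by rewrite sqr_sqrtr // dotvv_ge0. Qed.

Lemma normv_gt0 u : u != 0 -> 0 < normv u.
Proof. by move=> u0; rewrite sqrtr_gt0 dotvv_gt0. Qed.

Lemma line_cos_ge0 u v : 0 <= line_cos u v.
Proof. by rewrite divr_ge0 // mulr_ge0 // sqrtr_ge0. Qed.

Lemma line_cos_le u v k : u != 0 -> v != 0 -> 0 <= k ->
  dotv u v ^+ 2 <= k ^+ 2 * (dotv u u * dotv v v) -> line_cos u v <= k.
Proof.
move=> u0 v0 k0 h; rewrite /line_cos ler_pdivrMr ?mulr_gt0 ?normv_gt0 //.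
rewrite -(ler_pXn2r (ltn0Sn 1)) ?nnegrE ?normr_ge0 //; last first.
  by rewrite !mulr_ge0 // sqrtr_ge0.
by rewrite real_normK ?num_real // !exprMn !normvE.
Qed.

Lemma line_cos_le1 u v : u != 0 -> v != 0 -> line_cos u v <= 1.
Proof.
by move=> u0 v0; apply: line_cos_le => //; rewrite expr1n mul1r dotv_CauchySchwarz.
Qed.

Lemma line_angle_le u v u' v' : u != 0 -> v != 0 -> u' != 0 -> v' != 0 ->
  line_cos u' v' <= line_cos u v -> line_angle u v <= line_angle u' v'.
Proof.
move=> u0 v0 u0' v0' h.
have b (x y : 'rV[R]_n) : x != 0 -> y != 0 -> -1 <= line_cos x y <= 1.
  move=> x0 y0; apply/andP; split; last exact: line_cos_le1.
  by apply: le_trans (line_cos_ge0 x y); rewrite oppr_le0.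
rewrite leNgt -ltr_cos ?in_itv /= ?acos_ge0 ?acos_lepi ?b // -leNgt.
by rewrite !acosK ?in_itv /= ?b.
Qed.

Lemma sin2_line_angle u v : dotv u u = 1 -> dotv v v = 1 ->
  sin (line_angle u v) ^+ 2 = 1 - dotv u v ^+ 2.
Proof.
move=> u1 v1.
rewrite sin2cos2 acosK; last first.
  rewrite in_itv /= line_cos_le1 ?dotv1_neq0 // andbT.
  by apply: le_trans (line_cos_ge0 u v); rewrite oppr_le0.
by rewrite /line_cos /normv u1 v1 sqrtr1 mulr1 divr1 real_normK ?num_real.
Qed.

(** Two free matrices let one statement cover the norm, the constraint that a projection fixes [u],
    and the objective [dotv (u *m Q) u]. *)
Lemma dotv_mulmx_continuous A B :
  continuous (fun u => dotv (u *m A) (u *m B) : R^o).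
Proof.
have lin A' i : continuous (fun u => (u *m A') 0 i : R^o).
  rewrite (_ : (fun u => _) = fun u => \sum_k u 0 k * A' k i : R^o).
    apply: continuous_big => [|k _]; first exact: add_continuous.
    by move=> u; apply: (cvgM (@coord_continuous R 1 n 0 k u)); exact: cvg_cst.
  by apply/funext => u; rewrite mxE.
rewrite (_ : (fun u => _) = fun u => \sum_i (u *m A) 0 i * (u *m B) 0 i : R^o).
  apply: continuous_big => [|k _]; first exact: add_continuous.
  by move=> u; exact: (cvgM (@lin A k u) (@lin B k u)).
by apply/funext => u; rewrite dotvE.
Qed.

(** The unit sphere of the image of [P] is compact, so the quadratic form of [Q] attains its maximum
    there; homogeneity extends the bound to all [w]. *)
Lemma orth_proj_max P Q : orth_proj P -> P != 0 ->
  exists u, [/\ dotv u u = 1, u *m P = u &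
    forall w, w *m P = w -> dotv (w *m Q) w <= dotv (u *m Q) u * dotv w w].
Proof.
move=> [PT PP] P0.
(* The condition [u *m P = u] is written as the vanishing of a squared norm, so that [K] is an
   intersection of level sets of continuous functions. *)
pose K := ([set u | dotv u u = 1] `&`
  [set u | dotv (u *m (P - 1%:M)) (u *m (P - 1%:M)) = 0])%classic.
have KE u : K u <-> dotv u u = 1 /\ u *m P = u.
  split=> -[/= u1 h]; split => //=.
    by apply/eqP; rewrite -subr_eq0 -{2}[u]mulmx1 -mulmxBr; apply/eqP/dotvv_eq0.
  by rewrite mulmxBr mulmx1 h subrr /dotv mul0mx mxE.
have normalize w : w != 0 -> w *m P = w -> K ((normv w)^-1 *: w).
  move=> w0 wP; apply/KE; rewrite -scalemxAl wP; split => //.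
  rewrite dotvZl dotvZr -normvE expr2.
  by have := normv_gt0 w0; rewrite lt0r => /andP[nw _]; field.
have K0 : (K !=set0)%classic.
  have /rowV0Pn[w /submxP[x ->] w0] := P0.
  by eexists; apply: normalize w0 _; rewrite -mulmxA PP.
have Kcl : closed K.
  have cl A (a : R) : closed [set u | dotv (u *m A) (u *m A) = a]%classic.
    apply: (@preimage_closed _ _ (fun u => dotv (u *m A) (u *m A)) [set a]).
      by move=> u _; exact: dotv_mulmx_continuous.
    exact: closed_eq.
  apply: closedI; last exact: cl.
  have := cl 1%:M 1; rewrite (_ : [set u | _] = [set u | dotv u u = 1])%classic //.
  by apply/seteqP; split => u /=; rewrite mulmx1.
(* The norm on row vectors is the maximum of the absolute entries, and each entry of a unit vector
   is at most 1 in absolute value. *)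
have Kbd : bounded_set K.
  exists 1; split => // M M1 u [/= u1 _].
  apply: le_trans (ltW M1); rewrite [leLHS]/Num.norm /= mx_normrE.
  apply/bigmax_leP; split => // -[i j] _ /=; rewrite ord1.
  rewrite -(@expr_le1 _ 2) ?normr_ge0 // real_normK ?num_real //.
  rewrite -u1 dotvE (bigD1 j) //= -expr2 lerDl.
  by apply: sumr_ge0 => l _; rewrite -expr2 sqr_ge0.
have [u uK umax] := EVT_max_rV K0 (bounded_closed_compact Kbd Kcl)
  (continuous_subspaceT (@dotv_mulmx_continuous Q 1%:M)).
have /KE[u1 uP] := set_mem uK; exists u; split => // w wP.
have [->|w0] := eqVneq w 0; first by rewrite mul0mx /dotv !mul0mx !mxE mulr0.
have := umax _ (mem_set (normalize _ w0 wP)).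
rewrite !mulmx1 -scalemxAl dotvZl dotvZr mulrA -invfM -expr2 normvE.
by rewrite mulrC ler_pdivrMr ?dotvv_gt0.
Qed.

(** Here [k] is the cosine of the first principal angle. The relations [u *m Q = k *: v] and
    [v *m P = k *: u] are what makes the traces after deflation computable. *)
Lemma principal_pair P Q : orth_proj P -> orth_proj Q -> P != 0 -> Q != 0 ->
  exists u v k, [/\ dotv u u = 1, dotv v v = 1, u *m P = u & v *m Q = v] /\
    [/\ 0 <= k, u *m Q = k *: v, v *m P = k *: u &
      forall u' v', u' *m P = u' -> v' *m Q = v' ->
        dotv u' v' ^+ 2 <= k ^+ 2 * (dotv u' u' * dotv v' v')].
Proof.
move=> hP hQ P0 Q0; have [PT PP] := hP; have [QT QQ] := hQ.
have [u [u1 uP umax]] := orth_proj_max Q hP P0.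
pose k := normv (u *m Q).
have k2 : k ^+ 2 = dotv (u *m Q) u.
  by rewrite normvE dotv_mulmx // -mulmxA QQ dotvC.
have [v [v1 vQ uQ]] : exists v, [/\ dotv v v = 1, v *m Q = v & u *m Q = k *: v].
  have [uQ0|uQ0] := eqVneq (u *m Q) 0.
    (* With [k = 0] any unit vector of the image of [Q] will do; maximizing the zero form supplies
       one. *)
    have [v [v1 vQ _]] := orth_proj_max 0 hQ Q0; exists v; split => //.
    by rewrite /k uQ0 /normv /dotv mul0mx mxE sqrtr0 scale0r.
  have k0 : k != 0 by rewrite gt_eqF // normv_gt0.
  exists (k^-1 *: (u *m Q)); rewrite scalerA divff // scale1r; split => //.
    by rewrite dotvZl dotvZr -normvE -/k; field.
  by rewrite -scalemxAl -mulmxA QQ.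
(* As [Q] fixes [v'], the product of [u'] and [v'] is that of [u' *m Q] and [v']. Cauchy-Schwarz and
   the maximality of [u] finish. *)
have bound u' v' : u' *m P = u' -> v' *m Q = v' ->
    dotv u' v' ^+ 2 <= k ^+ 2 * (dotv u' u' * dotv v' v').
  move=> uP' vQ'; rewrite -vQ' -dotv_mulmx // vQ'.
  apply: le_trans (dotv_CauchySchwarz _ _) _.
  rewrite mulrA ler_wpM2r ?dotvv_ge0 // k2.
  by apply: le_trans (umax _ uP'); rewrite [leRHS]dotvC dotv_mulmx // -mulmxA QQ.
have uv : dotv u v = k by rewrite -vQ -dotv_mulmx // uQ dotvZl v1 mulr1.
exists u, v, k; split => //; split => //; first exact: sqrtr_ge0.
(* [bound] applied to [v *m P] and [v] bounds [|v *m P|] by [k], and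
   [v *m P = k *: u] follows by expanding [|v *m P - k *: u| ^+ 2]. *)
have vPvP : dotv (v *m P) (v *m P) <= k ^+ 2.
  have vPv : dotv (v *m P) v = dotv (v *m P) (v *m P).
    by rewrite [RHS]dotv_mulmx // -mulmxA PP dotvC.
  have [->|vP0] := eqVneq (v *m P) 0; first by rewrite /dotv mul0mx mxE sqr_ge0.
  have := bound (v *m P) v; rewrite vPv v1 mulr1 -mulmxA PP => /(_ erefl vQ).
  by rewrite expr2 ler_pM2r // dotvv_gt0.
apply/eqP; rewrite -subr_eq0; apply/eqP/dotvv_eq0/eqP.
rewrite eq_le dotvv_ge0 andbT -scaleNr !(dotvDl, dotvDr, dotvZl, dotvZr) u1.
have vPu : dotv (v *m P) u = k by rewrite dotv_mulmx // uP dotvC.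
rewrite (dotvC u) vPu; lra.
Qed.

(** For a unit vector [u] of the image of [P], this is the projection onto the orthogonal complement
    of [u] in that image. *)
Definition deflate P u := P - u^T *m u.

Lemma trmulmx_row u v : (u *m v^T) = (dotv u v)%:M.
Proof. by rewrite [LHS]mx11_scalar. Qed.

Section Deflate.
Variables (P : 'M[R]_n) (u : 'rV[R]_n).
Hypotheses (hP : orth_proj P) (u1 : dotv u u = 1) (uP : u *m P = u).

Lemma orth_proj_deflate : orth_proj (deflate P u).
Proof.
have [PT PP] := hP; split; first by rewrite /deflate linearB /= trmx_mul trmxK PT.
have PuT : P *m u^T = u^T by rewrite -[P]PT -trmx_mul uP.
rewrite /deflate mulmxBl !mulmxBr PP [P *m _]mulmxA PuT -[_ *m u *m P]mulmxA uP.
by rewrite mulmxA -[_ *m u *m u^T]mulmxA trmulmx_row u1 mulmx1 subrr subr0.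
Qed.

Lemma mxtrace_deflate : \tr (deflate P u) = \tr P - 1.
Proof. by rewrite /deflate linearB /= mxtrace_mulC trmulmx_row u1 mxtrace1. Qed.

(** This carries the link between a space and its projection through the recursion of
    [principal_angles], which intersects with [orthl u]. *)
Lemma sub_deflate A : (forall w, (w <= A)%MS = (w *m P == w)) ->
  forall w, (w <= A :&: orthl u)%MS = (w *m deflate P u == w).
Proof.
have [PT PP] := hP; move=> hA w; rewrite sub_capmx hA /orthl sub_kermx.
have PuT : P *m u^T = u^T by rewrite -[P]PT -trmx_mul uP.
apply/andP/eqP => [[/eqP wP /eqP wu]|wE].
  by rewrite /deflate mulmxBr mulmxA wu mul0mx subr0.
split; apply/eqP; rewrite -{1}wE -mulmxA.
  by rewrite -[RHS]wE /deflate mulmxBl PP -mulmxA uP.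
by rewrite /deflate mulmxBl PuT -mulmxA trmulmx_row u1 mulmx1 subrr mulmx0.
Qed.

End Deflate.

(** The trace of an orthogonal projection is the sum of the squares of its entries. *)
Lemma orth_proj_trace0 P : orth_proj P -> \tr P = 0 -> P = 0.
Proof.
move=> [PT PP] tP.
have diag i : P i i = \sum_l P i l ^+ 2.
  rewrite -[in LHS]PP mxE; apply: eq_bigr => l _.
  by rewrite -[in X in _ * X = _]PT mxE expr2.
have sq_ge0 i : 0 <= \sum_l P i l ^+ 2 by apply: sumr_ge0 => l _; exact: sqr_ge0.
have diag0 : \sum_i \sum_l P i l ^+ 2 = 0.
  by rewrite -[RHS]tP; apply: eq_bigr => i _; rewrite diag.
have row0 i : \sum_l P i l ^+ 2 = 0.
  by move/psumr_eq0P: diag0 => ->.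
apply/matrixP => i j; rewrite mxE; apply/eqP; rewrite -sqrf_eq0.
by move/psumr_eq0P: (row0 i) => -> // l _; exact: sqr_ge0.
Qed.

(** Induction on the dimension, deflating both projections along a principal pair. A code bounds
    every value of [chordal_dist] from below, so exhibiting one list of angles yields the inequality
    on traces. *)
Lemma ex_principal_angles k : forall P Q A B, orth_proj P -> orth_proj Q ->
  (forall w, (w <= A)%MS = (w *m P == w)) ->
  (forall w, (w <= B)%MS = (w *m Q == w)) ->
  \tr P = k%:R -> \tr Q = k%:R ->
  exists th, [/\ size th = k, principal_angles A B th &
    \sum_(t <- th) sin t ^+ 2 = k%:R - \tr (P *m Q)].
Proof.
elim: k => [|k IH] P Q A B hP hQ hA hB tP tQ.
  exists [::]; split => //; rewrite big_nil.
  have P0 : P = 0 by exact: orth_proj_trace0.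
  by rewrite P0 mul0mx mxtrace0 subrr.
have nz (S : 'M[R]_n) : \tr S = k.+1%:R -> S != 0.
  move=> tS; apply/eqP => S0; move: tS; rewrite S0 mxtrace0 => /eqP.
  by rewrite eq_sym pnatr_eq0.
have [u [v [c [[u1 v1 uP vQ] [c0 uQ vP bound]]]]] :=
  principal_pair hP hQ (nz _ tP) (nz _ tQ).
have uv : dotv u v = c by rewrite -vQ -dotv_mulmx ?(proj1 hQ) // uQ dotvZl v1 mulr1.
have tP1 : \tr (deflate P u) = k%:R.
  by rewrite mxtrace_deflate // tP -natr1 addrK.
have tQ1 : \tr (deflate Q v) = k%:R.
  by rewrite mxtrace_deflate // tQ -natr1 addrK.
have [th [sz pa sth]] := IH _ _ _ _ (orth_proj_deflate hP u1 uP)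
  (orth_proj_deflate hQ v1 vQ) (sub_deflate hP u1 uP hA) (sub_deflate hQ v1 vQ hB)
  tP1 tQ1.
have u0 := dotv1_neq0 u1; have v0 := dotv1_neq0 v1.
exists (line_angle u v :: th); split; first by rewrite /= sz.
  exists u, v; split; first by split; rewrite ?hA ?hB ?uP ?vQ.
  split => // u' v' u0' v0'; rewrite hA hB => /eqP uP' /eqP vQ'.
  apply: line_angle_le => //.
  have -> : line_cos u v = c.
    by rewrite /line_cos /normv u1 v1 sqrtr1 mulr1 divr1 uv ger0_norm.
  by apply: line_cos_le => //; exact: bound.
rewrite big_cons sth sin2_line_angle // uv.
(* The three traces involving [u] or [v] all equal [c ^+ 2], so deflation lowers tr(PQ) by [c ^+ 2];
   this cancels the [c ^+ 2] in the first squared sine. *)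
rewrite /deflate mulmxBl !mulmxBr !linearB /=.
have -> : \tr (P *m (v^T *m v)) = c ^+ 2.
  rewrite mulmxA mxtrace_mulC mulmxA vP -scalemxAl trmulmx_row uv.
  by rewrite scale_scalar_mx mxtrace_scalar expr2.
have -> : \tr (u^T *m u *m Q) = c ^+ 2.
  rewrite -mulmxA mxtrace_mulC uQ -scalemxAl trmulmx_row dotvC uv.
  by rewrite scale_scalar_mx mxtrace_scalar expr2.
have -> : \tr (u^T *m u *m (v^T *m v)) = c ^+ 2.
  rewrite -mulmxA mxtrace_mulC mulmxA trmulmx_row uv mul_scalar_mx -scalemxAl.
  by rewrite trmulmx_row dotvC uv scale_scalar_mx mxtrace_scalar expr2.
rewrite -natr1; ring.
Qed.

End Angles.

(** * The orthogonal projection onto a row space *)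

Section RowProj.
Variables (R : realType) (m n : nat) (p : 'M[R]_(m, n)).
Hypothesis p_free : row_free p.

Definition row_proj : 'M[R]_n := p^T *m invmx (p *m p^T) *m p.

(** If [x] annihilates the Gram matrix, then [x *m p] has squared norm 0, and freeness of the rows
    gives [x = 0]. *)
Lemma gram_unitmx : p *m p^T \in unitmx.
Proof.
rewrite -row_free_unit -kermx_eq0; apply/rowV0P => x /sub_kermxP xpp.
apply/eqP; rewrite -(mulmx_free_eq0 x p_free); apply/eqP/dotvv_eq0.
by rewrite /dotv trmx_mul mulmxA -(mulmxA x) xpp mul0mx mxE.
Qed.

Lemma orth_proj_row_proj : orth_proj row_proj.
Proof.
split; first by rewrite /row_proj !trmx_mul trmx_inv trmx_mul !trmxK mulmxA.
rewrite /row_proj -!mulmxA (mulmxA p p^T) (mulmxA (p *m p^T)) mulmxV ?mul1mx //.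
exact: gram_unitmx.
Qed.

Lemma mxtrace_row_proj : \tr row_proj = m%:R.
Proof. by rewrite /row_proj mxtrace_mulC mulmxA mulmxV ?gram_unitmx // mxtrace1. Qed.

Lemma sub_row_proj w : (w <= <<p>>)%MS = (w *m row_proj == w :> 'rV_n).
Proof.
rewrite genmxE; apply/idP/eqP => [/submxP[x ->]|<-].
  by rewrite /row_proj !mulmxA -(mulmxA x) mulmxK ?gram_unitmx.
by rewrite /row_proj mulmxA submxMl.
Qed.

End RowProj.

(** * From codes to families of projections, and the final bound *)

Lemma dot2_mxtrace (R : realFieldType) n (P Q : 'M[R]_n) :
  orth_proj Q -> dot2 P Q = \tr (P *m Q).
Proof.
move=> hQ; apply: eq_bigr => i _; rewrite mxE; apply: eq_bigr => j _.
by rewrite (orth_proj_sym i j hQ).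
Qed.

Lemma delta_code_dot2 (R : realType) (m n : nat) (delta : R)
    (C : seq 'M[R]_(m, n)) (p q : 'M[R]_(m, n)) :
  0 < delta -> delta_code delta C -> p \in C -> q \in C -> p != q ->
  dot2 (row_proj p) (row_proj q) <= m%:R - delta ^+ 2.
Proof.
move=> delta0 [_ /allP free sep] pC qC pq.
have [p_free q_free] := (free _ pC, free _ qC).
have [th [sz pa sumE]] := ex_principal_angles
  (orth_proj_row_proj p_free) (orth_proj_row_proj q_free)
  (sub_row_proj p_free) (sub_row_proj q_free)
  (mxtrace_row_proj p_free) (mxtrace_row_proj q_free).
have := sep p q pC qC pq (Num.sqrt (\sum_(t <- th) sin t ^+ 2)).
rewrite sumE -dot2_mxtrace; last exact: orth_proj_row_proj.
move=> /(_ (ex_intro _ th _)) le_delta; rewrite lerBrDr -lerBrDl.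
have {}le_delta : delta <= Num.sqrt (m%:R - dot2 (row_proj p) (row_proj q)).
  apply: le_delta; split => //; rewrite sumE -dot2_mxtrace //.
  exact: orth_proj_row_proj.
(* The square root of a negative number is 0 by convention, so a root at least [delta > 0] forces a
   positive radicand. *)
have d0 : 0 < m%:R - dot2 (row_proj p) (row_proj q).
  by rewrite -sqrtr_gt0 (lt_le_trans delta0).
by rewrite -(sqr_sqrtr (ltW d0)) ler_pXn2r ?nnegrE ?sqrtr_ge0 // ltW.
Qed.

(** The upper limit is the larger root of x^2 - b x - c. For 2 x >= b the distance from [x] to b/2
    is less than the square root; for 2 x < b already x (b - x) > 0. *)
Lemma quadratic_gt0 (R : rcfType) (b c x : R) :
  0 < c -> 0 < x -> x < b / 2 + Num.sqrt (b ^+ 2 / 4 + c) ->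
  0 < - x ^+ 2 + b * x + c.
Proof.
move=> c0 x0 xb.
have disc0 : 0 <= b ^+ 2 / 4 + c by have := sqr_ge0 b; lra.
have := sqr_sqrtr disc0; have := sqrtr_ge0 (b ^+ 2 / 4 + c); move: xb.
move: (Num.sqrt _) => r xb r0 r2.
have [b2x|x2b] := lerP b (2 * x); first by nra.
by have := mulr_gt0 x0 (_ : 0 < b - x); nra.
Qed.

Theorem theorem3p2 (R : realType) (m n : nat) (delta : R)
  (C : seq 'M[R]_(m, n)) :
  (1 <= m)%N -> (m.*2 <= n)%N -> 0 < delta ->
  let s := m%:R - delta ^+ 2 in
  let d := 2 * m%:R * (n%:R - m%:R) / (n%:R * (n%:R - 1) * (n%:R + 2)) in
  let b := 4 * (n%:R - 2 * m%:R) ^+ 2 / (n%:R * (n%:R - 2) * (n%:R + 4)) in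
  let c := 2 * m%:R ^+ 2 * (n%:R - m%:R) ^+ 2
             / (n%:R ^+ 2 * (n%:R - 1) * (n%:R + 2)) in
  let x := s - m%:R ^+ 2 / n%:R in
  0 < x -> x < b / 2 + Num.sqrt (b ^+ 2 / 4 + c) ->
  delta_code delta C ->
  (size C)%:R <= (m%:R - s) * (x + d) ^+ 2 * (n%:R - 1) * (n%:R + 2)
                   / (2 * x * (- x ^+ 2 + b * x + c)).
Proof.
move=> m1 mn delta0 s d b c x x0 xb code; have [C_uniq /allP free _] := code.
have mu1 : 1 <= m%:R :> R by rewrite ler1n.
have nu2 : 2 * m%:R <= n%:R :> R by rewrite -natrM ler_nat mul2n.
have c0 : 0 < c := @c_gt0 R n m m1 mn.
have q0 := quadratic_gt0 c0 x0 xb.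
have s_lt : s < m%:R by rewrite gtrBl exprn_gt0.
pose P (i : 'I_(size C)) := row_proj (nth 0 C i).
have P_free i : row_free (nth 0 C (i : 'I_(size C))).
  by apply: free; exact: mem_nth.
have := @code_bound R n m 'I_(size C) P m1 mn
  (fun i => orth_proj_row_proj (P_free i)) (fun i => mxtrace_row_proj (P_free i))
  s x0 s_lt q0.
rewrite card_ord => /(_ _)/le_trans; apply.
  move=> i j ij; apply: (delta_code_dot2 delta0 code); rewrite ?mem_nth //.
  by rewrite nth_uniq.
(* The two bounds agree: with z0 = m (n - m)/n one has c = z0 d, hence z0 x + c = z0 (x + d), and
   z0^2/c = (n - 1)(n + 2)/2. *)
rewrite le_eqVlt; apply/orP; left; apply/eqP.
(* Generalizing the quadratic hides [b], whose denominator vanishes for n = 2. *)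
move: (- x ^+ 2 + b * x + c) q0 => q q0; rewrite -/x /c /d.
clearbody x; move: (m%:R - s) => y.
have neq (t : R) : 0 < t -> t != 0 by move=> /gt_eqF ->.
by field; rewrite !neq //; lra.
Qed.
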